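(* Let $H:\mathbb{R}^d\to\mathbb{R}$ be twice continuously differentiable with $\nabla H(0)=0$. Let $S\in\mathbb{R}^{d\times d}$ be a constant matrix such that $S^\top=-S$ or $S\preceq 0$. Let $D(t)\in\mathbb{R}^{d\times d}$ be a time-dependent matrix, and define $P_H(z)=\int_0^1\nabla^2H(sz)\,ds$. Assume the energy-compatible linear damping condition $$\operatorname{sym}\big(P_H(z)D(t)\big)\succeq 0\qquad\text{for all }(z,t).$$ Then every solution $z(t)$ of $$\dot z=S\,\nabla H(z)-D(t)\,z$$ satisfies $$\frac{d}{dt}H\big(z(t)\big)=\nabla H(z)^\top S\,\nabla H(z)-z^\top\operatorname{sym}\big(P_H(z)D(t)\big)z\;\le\;0 ,$$ where the right-hand side is evaluated at $z=z(t)$.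
   Context: For a square real matrix $A$, $\operatorname{sym}(A)=\tfrac12(A+A^\top)$. $A\succeq 0$ means that $A$ is symmetric positive semidefinite. $S\preceq 0$ means that $\operatorname{sym}(S)$ is negative semidefinite ($S$ need not be symmetric). $\nabla^2H$ is the Hessian of $H$. *)

(* Defs.v *)
From HB Require Import structures.
From mathcomp Require Import all_boot all_order all_algebra.
From mathcomp Require Import all_classical all_reals all_analysis.

Set Implicit Arguments.
Unset Strict Implicit.
Unset Printing Implicit Defensive.

Import Order.TTheory GRing.Theory Num.Theory.
Import numFieldNormedType.Exports.

Local Open Scope classical_set_scope.
Local Open Scope ring_scope.

Section Matrices.
Variables (R : realType) (d : nat).
Implicit Types (A : 'M[R]_d) (x : 'cV[R]_d).

Definition quadf A x : R := (x^T *m A *m x) 0 0.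

Definition symmx A : 'M[R]_d := 2^-1 *: (A + A^T).

Definition psdmx A : Prop := A^T = A /\ forall x, 0 <= quadf A x.

Definition nsdmx A : Prop := A^T = A /\ forall x, quadf A x <= 0.

End Matrices.

Section Calculus.
Variables (R : realType) (d : nat).
Implicit Types (H : 'cV[R]_d -> R) (z : 'cV[R]_d).

Definition grad H z : 'cV[R]_d := \col_i 'D_(delta_mx i 0) H z.

(* The Hessian is the Jacobian matrix of [grad H]: the entry (i, j) is the
   j-th partial derivative of the i-th partial derivative of [H]. *)
Definition hess H z : 'M[R]_d :=
  \matrix_(i, j) 'D_(delta_mx j 0) (fun w => grad H w i 0) z.

(* [differentiable] is Fréchet differentiability, so [grad H] and [hess H]
   then represent the first and second derivatives. *)
Definition twice_cont_diff H : Prop :=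
  [/\ forall z, differentiable H z,
      forall z, differentiable (grad H) z
    & continuous (hess H)].

(* P_H(z), the integral over [0, 1] being taken entrywise. *)
Definition avg_hess H z : 'M[R]_d :=
  \matrix_(i, j)
    (\int[@lebesgue_measure R]_(s in `[0%R, 1%R]) hess H (s *: z) i j)%R.

End Calculus.

(* Derivative at [t] of a function restricted to [J]: the usual derivative if
   [t] is interior to [J], a one-sided derivative at an endpoint of an
   interval [J]. *)
Definition is_derive_within (R : realType) (V : normedModType R)
    (J : set R) (f : R -> V) (t : R) (l : V) : Prop :=
  (s - t)^-1 *: (f s - f t) @[s --> within J (t^')] --> l.

(* [J] is an interval with at least two points; it may be open, closed,
   half-open, bounded or not. *)
Definition is_solution (R : realType) (d : nat) (H : 'cV[R]_d -> R)
    (S : 'M[R]_d) (D : R -> 'M[R]_d) (J : set R) (z : R -> 'cV[R]_d) : Prop :=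
  [/\ is_interval J,
      exists a b, [/\ J a, J b & a < b]
    & forall t, J t ->
        is_derive_within J z t (S *m grad H (z t) - D t *m z t)].

(* Main.v *)
Require Import Defs.
From HB Require Import structures.
From mathcomp Require Import all_boot all_order all_algebra.
From mathcomp Require Import all_classical all_reals all_analysis.

Import Order.TTheory GRing.Theory Num.Theory.
Import numFieldNormedType.Exports.

Local Open Scope classical_set_scope.
Local Open Scope ring_scope.

(** The proof is the chain rule followed by algebra. Along a solution, the
    derivative of the energy is the differential of [H] applied to the velocity,
    [(grad H z)^T *m (S *m grad H z - D t *m z)] ([is_derive_within_comp],
    [diff_grad]). Integrating the derivative of [s |-> grad H (s *: z)] over
    [0, 1], and using that the origin is a critical point, gives
    [avg_hess H z *m z = grad H z] ([avg_hess_mul]). The averaged Hessian is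
    symmetric, so [(grad H z)^T *m D t *m z] is the value at [z] of the quadratic
    form of [avg_hess H z *m D t], which only depends on the symmetric part of
    that matrix; the damping condition makes it nonnegative. The remaining
    term is the value at [grad H z] of the quadratic form of [S], which vanishes
    if [S] is skew-symmetric and is nonpositive if the symmetric part of [S] is
    negative semidefinite.

    The symmetry of the averaged Hessian is essential: the transpose of
    [grad H z = avg_hess H z *m z] is multiplied by the matrix [D t], whereas
    the damping condition is about [avg_hess H z *m D t]. It comes from
    Schwarz's theorem on mixed derivatives ([derive_comm]), proved here by
    writing a second difference of [f] as a multiple of each of the two mixed
    derivatives at nearby points, by the mean value theorem. *)

(** * Schwarz's theorem *)

Section LineRestriction.
Variables (R : realType) (V : normedModType R).

(** The derivative of [f] along the line through [x] directed by [u] is a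
    directional derivative of [f]. *)
Lemma is_derive_line (f : V -> R) (x u : V) (s : R) :
  derivable f (x + s *: u) u ->
  is_derive s 1 (fun r => f (x + r *: u)) ('D_u f (x + s *: u)).
Proof.
move=> df.
have quotE : (fun h : R => h^-1 *:
      (((fun r => f (x + r *: u)) \o shift s) (h *: 1) - f (x + s *: u))) =
    (fun h => h^-1 *: ((f \o shift (x + s *: u)) (h *: u) - f (x + s *: u))).
  apply/funext => h /=; congr (_ *: (f _ - _)).
  by rewrite scalerDl addrCA /GRing.scale/= mulr1.
by split; rewrite /derivable /derive quotE.
Qed.

Lemma MVT_line (f : V -> R) (x u : V) (h : R) :
  0 < h -> (forall y, derivable f y u) ->
  exists2 c, c \in `]0, h[ & f (x + h *: u) - f x = h * 'D_u f (x + c *: u).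
Proof.
move=> h0 df.
have dline s := is_derive_line f x u s (df (x + s *: u)).
have [|c c0h] := @MVT R _ _ 0 h h0 (fun s _ => dline s).
  by apply: derivable_within_continuous => s _; exact: ex_derive.
by rewrite scale0r addr0 subr0 mulrC => fE; exists c.
Qed.

(** The mean value theorem used twice, first in the direction [u] for
    [y |-> f (y + h *: v) - f y], then in the direction [v] for ['D_u f]. *)
Lemma second_difference (f : V -> R) (x u v : V) (h : R) : 0 < h ->
  (forall y, derivable f y u) -> (forall y, derivable ('D_u f) y v) ->
  exists s r, [/\ s \in `]0, h[, r \in `]0, h[ &
    f (x + h *: u + h *: v) - f (x + h *: u) - f (x + h *: v) + f x =
    h * (h * 'D_v ('D_u f) (x + s *: u + r *: v))].
Proof.
move=> h0 df ddf.
pose g y := f (y + h *: v) - f y.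
have dg y : is_derive y u g ('D_u f (y + h *: v) - 'D_u f y).
  have dfv : is_derive y u (fun w => f (w + h *: v)) ('D_u f (y + h *: v)).
    have quotE : (fun k : R => k^-1 *:
        (((fun w => f (w + h *: v)) \o shift y) (k *: u) - f (y + h *: v))) =
      (fun k => k^-1 *: ((f \o shift (y + h *: v)) (k *: u) - f (y + h *: v))).
      by apply/funext => k /=; rewrite addrA.
    by split; rewrite /derivable /derive quotE //; exact: df.
  have dfy : is_derive y u f ('D_u f y) by exact: derivableP.
  exact: is_deriveB.
have [|s s0h gE] := MVT_line g x u h h0; first by move=> y; exact: ex_derive.
have [r r0h DE] := MVT_line ('D_u f) (x + s *: u) v h h0 ddf.
exists s, r; split => //.
rewrite -DE -(derive_val (is_derive := dg (x + s *: u))) -gE /g.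
by rewrite opprB addrA addrAC.
Qed.

(** Schwarz's theorem. The second difference is symmetric in [u] and [v], so one
    mixed derivative at some point equals the other mixed derivative at another
    point, both points being arbitrarily close to [x]; continuity at [x]
    concludes. *)
Lemma derive_comm (f : V -> R) (x u v : V) :
  (forall y, derivable f y u) -> (forall y, derivable f y v) ->
  (forall y, derivable ('D_u f) y v) -> (forall y, derivable ('D_v f) y u) ->
  {for x, continuous ('D_v ('D_u f))} -> {for x, continuous ('D_u ('D_v f))} ->
  'D_v ('D_u f) x = 'D_u ('D_v f) x.
Proof.
move=> dfu dfv dfuv dfvu cuv cvu.
apply/eqP; rewrite -subr_eq0 -normr_le0; apply/ler_addgt0Pr => e e0.
rewrite add0r.
have e20 : 0 < e / 2 by rewrite divr_gt0.
have nearuv : \forall y \near x, `|'D_v ('D_u f) x - 'D_v ('D_u f) y| < e / 2.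
  by have /cvgrPdist_lt/(_ _ e20) := cuv.
have nearvu : \forall y \near x, `|'D_u ('D_v f) x - 'D_u ('D_v f) y| < e / 2.
  by have /cvgrPdist_lt/(_ _ e20) := cvu.
have [d /= d0 ballP] := (nbhs_ballP _ _).1 (filterI nearuv nearvu).
(* The step [h] is such that [x + s *: u + r *: v] lies in the ball of radius
   [d] around [x] whenever [s] and [r] are in ]0, h[. *)
pose M := `|u| + `|v| + 1.
have M0 : 0 < M by rewrite ltr_wpDl// addr_ge0.
pose h := d / M.
have h0 : 0 < h by rewrite divr_gt0.
have small s r : s \in `]0, h[ -> r \in `]0, h[ ->
    ball x d (x + s *: u + r *: v).
  rewrite !in_itv/= => /andP[s0 sh] /andP[r0 rh].
  rewrite -ball_normE /ball_/= -addrA opprD addrA subrr sub0r normrN.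
  apply: (le_lt_trans (ler_normD _ _)); rewrite !normrZ !gtr0_norm//.
  apply: (@le_lt_trans _ _ (h * (`|u| + `|v|))).
    by rewrite mulrDr lerD// ler_wpM2r// ltW.
  by rewrite -[ltRHS](divfK (lt0r_neq0 M0)) ltr_pM2l// ltrDl.
have [s [r [sh rh E1]]] := second_difference f x u v h h0 dfu dfuv.
have [s' [r' [s'h r'h E2]]] := second_difference f x v u h h0 dfv dfvu.
have {E1 E2} E : 'D_v ('D_u f) (x + s *: u + r *: v) =
    'D_u ('D_v f) (x + r' *: u + s' *: v).
  apply: (mulfI (lt0r_neq0 h0)); apply: (mulfI (lt0r_neq0 h0)).
  rewrite (addrAC x (r' *: u)); apply: etrans (esym E1) _.
  apply: etrans _ E2; rewrite (addrAC x (h *: v)).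
  by congr (_ + f x); exact: addrAC.
have [+ _] := ballP _ (small _ _ sh rh).
have [_ +] := ballP _ (small _ _ r'h s'h).
rewrite E => A B; rewrite [leRHS]splitr.
rewrite -(subrKA ('D_u ('D_v f) (x + r' *: u + s' *: v))).
apply: le_trans (ler_normD _ _) _; apply: lerD; apply: ltW; first exact: B.
by rewrite distrC; exact: A.
Qed.

End LineRestriction.

(** * Chain rule relative to a set *)

(** The difference quotient of [f \o z] is ['d f (z t)] applied to the
    difference quotient [q] of [z], plus a remainder [r] which is small because
    [f] is differentiable at [z t] and [q] is bounded near [t]. *)
Lemma is_derive_within_comp (R : realType) (V W : normedModType R) (J : set R)
    (f : V -> W) (z : R -> V) (t : R) (l : V) :
  differentiable f (z t) -> is_derive_within J z t l ->
  is_derive_within J (f \o z) t ('d f (z t) l).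
Proof.
move=> df dz; rewrite /is_derive_within.
set F := within J (t^').
set q := fun s => (s - t)^-1 *: (z s - z t).
pose r s := (s - t)^-1 *: (f (z s) - f (z t)) - 'd f (z t) (q s).
have qcvg : q s @[s --> F] --> l by exact: dz.
have neqt : \forall s \near F, s != t.
  have : \forall s \near t^', s != t by exact: nbhs_dnbhs_neq.
  by apply: filterS => s ? _.
have stcvg : (s - t) @[s --> F] --> 0.
  rewrite -(subrr t); apply: cvgB; last exact: cvg_cst.
  by move=> A /nbhs_dnbhs At; exact: cvg_within.
have kcvg : (s - t) *: q s @[s --> F] --> (0 : V).
  by rewrite -(scale0r l); exact: cvgZ.
have rcvg : r s @[s --> F] --> (0 : W).
  apply/cvgr0Pnorm_le => e e0.
  have L0 : 0 < `|l| + 1 by rewrite ltr_wpDl.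
  have e'0 : 0 < e / (`|l| + 1) by rewrite divr_gt0.
  have qbnd : \forall s \near F, `|q s| < `|l| + 1.
    by apply: (cvgr_norm_lt _ qcvg); rewrite ltrDl.
  have osmall : \forall k \near (0 : V),
      `|f (k + z t) - f (z t) - 'd f (z t) k| <= e / (`|l| + 1) * `|k|.
    near=> k.
    rewrite (diff_locallyx df) -addrA -opprD addrAC subrr add0r.
    by near: k; exact: littleoP.
  have {osmall} osmall := kcvg _ osmall.
  near=> s.
  have st : s - t != 0 by rewrite subr_eq0; near: s.
  have zE : (s - t) *: q s = z s - z t by rewrite scalerA mulfV// scale1r.
  have -> : r s = (s - t)^-1 *:
      (f ((s - t) *: q s + z t) - f (z t) - 'd f (z t) ((s - t) *: q s)).
    by rewrite zE subrK scalerBr -linearZ.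
  rewrite normrZ normfV ler_pdivrMl ?normr_gt0//.
  have -> : `|s - t| * e = e / (`|l| + 1) * (`|s - t| * (`|l| + 1)).
    by rewrite mulrCA divfK// lt0r_neq0.
  apply: (@le_trans _ _ (e / (`|l| + 1) * `|(s - t) *: q s|)).
    by near: s.
  rewrite normrZ ler_wpM2l ?(ltW e'0)// ler_wpM2l// ltW//.
  by near: s.
apply: (@cvg_trans _ (('d f (z t) (q s) + r s) @[s --> F])).
  by apply: near_eq_cvg; near=> s; rewrite /r addrC subrK.
have dqcvg : 'd f (z t) (q s) @[s --> F] --> 'd f (z t) l.
  by apply: continuous_cvg => //; exact: diff_continuous.
rewrite -['d f (z t) l]addr0; exact: cvgD.
Unshelve. all: by end_near. Qed.

(** * Gradient and averaged Hessian *)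

Section Gradient.
Variables (R : realType) (d : nat).
Implicit Types x z : 'cV[R]_d.

Lemma col_sum_delta z : z = \sum_i z i 0 *: delta_mx i 0.
Proof.
rewrite [LHS]matrix_sum_delta; apply: eq_bigr => i _.
by rewrite big_ord_recl big_ord0 addr0.
Qed.

Lemma diff_grad (H : 'cV[R]_d -> R) z x : differentiable H z ->
  'd H z x = ((grad H z)^T *m x) 0 0.
Proof.
move=> dH; rewrite [in LHS](col_sum_delta x) raddf_sum mxE.
apply: eq_bigr => i _; rewrite !mxE deriveE// mulrC.
exact: (linearZ_LR ('d H z)).
Qed.

Variables (H : 'cV[R]_d -> R) (HC2 : twice_cont_diff H).

Let dH z : differentiable H z. Proof. by case: HC2. Qed.
Let dgrad z : differentiable (grad H) z. Proof. by case: HC2. Qed.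

Let gradE i : (fun w => grad H w i 0) = 'D_(delta_mx i 0) H.
Proof. by apply/funext => w; rewrite mxE. Qed.

Lemma differentiable_grad_coord z i :
  differentiable (fun w => grad H w i 0) z.
Proof.
apply: (@differentiable_comp _ _ _ _ (grad H) (fun M : 'cV[R]_d => M i 0)) => //.
exact: differentiable_coord.
Qed.

Lemma continuous_hess_coord i j : continuous (fun z => hess H z i j).
Proof.
move=> z; apply: (@continuous_comp _ _ _ (hess H) (fun M : 'M[R]_d => M i j)).
  by have [_ _ ch] := HC2; exact: ch.
exact: coord_continuous.
Qed.

Lemma hess_sym z : (hess H z)^T = hess H z.
Proof.
apply/matrixP => i j; rewrite !mxE !gradE.
have dgradi k y v : derivable ('D_(delta_mx k 0) H) y v.
  by rewrite -gradE; apply: diff_derivable; exact: differentiable_grad_coord.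
have chess k l : continuous ('D_(delta_mx l 0) ('D_(delta_mx k 0) H)).
  rewrite (_ : 'D__ _ = fun w => hess H w k l); first exact: continuous_hess_coord.
  by apply/funext => w; rewrite mxE gradE.
by apply: derive_comm => [y|y|y|y||]; [exact: diff_derivable|
  exact: diff_derivable|exact: dgradi|exact: dgradi|exact: chess|exact: chess].
Qed.

Lemma avg_hess_sym z : (avg_hess H z)^T = avg_hess H z.
Proof.
apply/matrixP => i j; rewrite !mxE; apply: eq_Rintegral => s _.
by rewrite -[in RHS]hess_sym [RHS]mxE.
Qed.

Let continuous_hess_line i j z : continuous (fun s : R => hess H (s *: z) i j).
Proof.
move=> s.
have cz : {for s, continuous (fun r : R => r *: z)}.
  by apply: scalel_continuous.
exact: (continuous_comp cz (continuous_hess_coord i j (s *: z))).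
Qed.

Lemma derive_grad_coord z x i :
  'D_x (fun w => grad H w i 0) z = (hess H z *m x) i 0.
Proof.
have dg := differentiable_grad_coord z i.
rewrite deriveE// (diff_grad (fun w => grad H w i 0))// !mxE.
by apply: eq_bigr => j _; rewrite !mxE.
Qed.

(** Entry by entry, the fundamental theorem of calculus for
    [s |-> grad H (s *: z)] on [0, 1]. *)
Lemma avg_hess_mul z : avg_hess H z *m z = grad H z - grad H 0.
Proof.
apply/colP => i; rewrite [LHS]mxE.
pose F (s : R) : R := grad H (s *: z) i 0.
pose f (s : R) : R := (hess H (s *: z) *m z) i 0.
have dF (s : R) : is_derive s (1 : R) F (f s).
  rewrite /f -derive_grad_coord -[s *: z]add0r.
  rewrite (_ : F = fun r => grad H (0 + r *: z) i 0); last first.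
    by apply/funext => r; rewrite add0r.
  apply: is_derive_line (fun w => grad H w i 0) _ _ _ _.
  by apply: diff_derivable; exact: differentiable_grad_coord.
have fE : f = fun s => \sum_j hess H (s *: z) i j * z j 0.
  by apply/funext => s; rewrite /f mxE.
have cf : continuous f.
  rewrite fE => s; apply: cvg_big => [|j _]; first exact: add_continuous.
  by apply: cvgMr_tmp; exact: continuous_hess_line.
have cF : continuous F.
  by move=> s; apply: differentiable_continuous; apply/derivable1_diffP.
have inth j : lebesgue_measure.-integrable `[0%R, 1%R]
    (EFin \o (fun s : R => hess H (s *: z) i j)).
  apply: continuous_compact_integrable; first exact: segment_compact.
  by apply: continuous_subspaceT; exact: continuous_hess_line.
have FTC : (\int[@lebesgue_measure R]_(s in `[0%R, 1%R]) (f s)%:E =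
    (F 1)%:E - (F 0)%:E)%E.
  apply: continuous_FTC2 => //; first exact: continuous_subspaceT.
    split=> [s _||]; first exact: ex_derive.
    - by apply: cvg_at_right_filter; exact: cF.
    - by apply: cvg_at_left_filter; exact: cF.
  by move=> s _; rewrite derive1E derive_val.
have -> : (grad H z - grad H 0) i 0 = F 1 - F 0.
  by rewrite /F scale1r scale0r !mxE.
apply: EFin_inj; rewrite EFinB -FTC fE -sumEFin.
transitivity (\int[@lebesgue_measure R]_(s in `[0%R, 1%R])
    \sum_j (hess H (s *: z) i j * z j 0)%:E)%E; last first.
  by apply: eq_integral => s _; rewrite -sumEFin.
rewrite integral_sum//=; last first.
  by move=> j; exact: (integrableZr _ (z j 0) (inth j)).
apply: eq_bigr => j _; rewrite mxE -RintegralZr// /Rintegral fineK//.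
apply: integrable_fin_num => //.
exact: (integrableZr _ (z j 0) (inth j)).
Qed.

End Gradient.

(** * Quadratic forms *)

Section QuadraticForms.
Variables (R : realType) (d : nat).
Implicit Types (A : 'M[R]_d) (x : 'cV[R]_d).

Lemma quadf_tr A x : quadf A^T x = quadf A x.
Proof.
rewrite /quadf -[in RHS](trmxK (x^T *m A *m x)) [RHS]mxE.
by rewrite !trmx_mul trmxK mulmxA.
Qed.

Lemma quadf_symmx A x : quadf (symmx A) x = quadf A x.
Proof.
rewrite /quadf /symmx -scalemxAr -scalemxAl mulmxDr mulmxDl.
rewrite mxE mxE -/(quadf A x) -/(quadf A^T x) quadf_tr.
by rewrite mulrDr mulrC -splitr.
Qed.

Lemma quadf_skew A x : A^T = - A -> quadf A x = 0.
Proof.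
move=> At; have : quadf A x = - quadf A x.
  by rewrite -{1}quadf_tr At /quadf mulmxN mulNmx mxE.
by move/eqP; rewrite -subr_eq0 opprK -mulr2n mulrn_eq0 => /eqP.
Qed.

End QuadraticForms.

(** * Energy dissipation *)

(* [T] is the time domain on which the damping matrix is given. *)
Theorem mainTheorem1 (R : realType) (d : nat) (H : 'cV[R]_d -> R)
    (S : 'M[R]_d) (T : set R) (D : R -> 'M[R]_d)
    (HC2 : twice_cont_diff H)
    (Hcrit : grad H 0 = 0)
    (HS : S^T = - S \/ nsdmx (symmx S))
    (Hdamp : forall (z : 'cV[R]_d) (t : R), T t ->
       psdmx (symmx (avg_hess H z *m D t))) :
  forall (J : set R) (z : R -> 'cV[R]_d),
    J `<=` T -> is_solution H S D J z ->
    forall t, J t ->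
      let rhs := quadf S (grad H (z t))
                 - quadf (symmx (avg_hess H (z t) *m D t)) (z t) in
      is_derive_within J (H \o z) t rhs /\ rhs <= 0.
Proof.
move=> J z JT [_ _ dz] t Jt rhs; split; last first.
  have [_ damp0] := Hdamp (z t) t (JT _ Jt).
  rewrite subr_le0; apply: le_trans (damp0 _).
  case: HS => [/quadf_skew->//|[_ S0]].
  by rewrite -quadf_symmx.
have dH : differentiable H (z t) by have [dH _ _] := HC2; exact: dH.
have rhsE : rhs = 'd H (z t) (S *m grad H (z t) - D t *m z t).
  rewrite diff_grad// mulmxBr mxE [X in _ + X]mxE mulmxA; congr (_ - _).
  rewrite quadf_symmx /quadf mulmxA.
  have -> : (grad H (z t))^T = (z t)^T *m avg_hess H (z t).
    by rewrite -(avg_hess_sym _ _ _ HC2) -trmx_mul avg_hess_mul// Hcrit subr0.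
  by rewrite -!mulmxA.
by rewrite rhsE; apply: is_derive_within_comp => //; exact: dz.
Qed.
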